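(* Let $\Theta$ be an OPT. If $\Theta$ does not satisfy local discriminability, then $\Theta$ admits of entangled states.
   Context: **Operational probabilistic theories (OPTs).** An OPT $\Theta$ consists of a class $\mathsf{Sys}(\Theta)$ of systems $A,B,\dots$ with a trivial system $I$ and an associative composition $(A,B)\mapsto AB$ with unit $I$ (systems may be reordered by deterministic swaps), and, for each pair $A,B$, a collection of tests $\{E_x\}_{x\in X}$ ($X$ a finite outcome set) made of events $E_x$ from $A$ to $B$; every event belongs to some test. Tests can be composed sequentially ($\circ$) and in parallel ($\boxtimes$), with identity events and the law $(\mathcal A\boxtimes\mathcal B)\circ(\mathcal C\boxtimes\mathcal D)=(\mathcal A\circ\mathcal C)\boxtimes(\mathcal B\circ\mathcal D)$ (a strict symmetric monoidal structure). Events from $I$ to $I$ are probabilities in $[0,1]$, composed by multiplication, and every test from $I$ to $I$ is a probability distribution. For a test $\{E_x\}_{x\in X}$ and $Y\subseteq X$ the coarse-graining $\sum_{y\in Y}E_y$ is an event (merging outcomes of a test gives a test), and both compositions distribute over sums. Events giving the same probabilities in all contexts are identified. States $\rho\in\mathsf{St}(A)$ are (classes of) events from $I$ to $A$; effects $a\in\mathsf{Eff}(A)$ are (classes of) events from $A$ to $I$; $(a|\rho)\in[0,1]$ is the resulting probability. Effects separate states and states separate effects, so $\mathsf{St}(A)$ is a subset of the real vector space $\mathsf{St}_{\mathbb R}(A)=\mathrm{span}_{\mathbb R}\,\mathsf{St}(A)$ and effects are linear functionals on it; sums of events are vector sums. $D_A=\dim\mathsf{St}_{\mathbb R}(A)$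 is assumed finite for all $A$. The null state $\varepsilon=0$ always belongs to $\mathsf{St}(A)$. An event is deterministic if it forms a test with a single outcome (so the full coarse-graining of a test is deterministic); compositions of deterministic events are deterministic; a state is deterministic iff every deterministic effect takes value $1$ on it. Every system has at least one preparation test (input $I$) and one observation test (output $I$). $\mathsf{St}(A)$ need not be convex. For states $\alpha\in\mathsf{St}(A)$, $\beta\in\mathsf{St}(B)$ the product state $\alpha\boxtimes\beta\in\mathsf{St}(AB)$ is written $\alpha\beta$; similarly for effects. **Local discriminability.** For every $m\ge 1$ and every $m$-partite system $S_1\cdots S_m$, the (conic combinations of) product effects $a_1\boxtimes\cdots\boxtimes a_m$ with $a_i\in\mathsf{Eff}(S_i)$ separate the states of $S_1\cdots S_m$. **Entangled states.** A state of a bipartite system $AB$ is separable if it is of the form $\sum_{i\in J}p_i\,\alpha_i\beta_i$ with $J$ finite (possibly empty), $p_i>0$, and non-null $\alpha_i\in\mathsf{St}(A)$, $\beta_i\in\mathsf{St}(B)$. A state of $AB$ is entangled if it is not separable. $\Theta$ admits of entangled states if for some systems $A,B$ there is an entangled state of $AB$. *)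

(* Defs.v *)
From mathcomp Require Import all_boot all_order all_algebra.
From mathcomp Require Import functions reals.

Set Implicit Arguments.
Unset Strict Implicit.
Unset Printing Implicit Defensive.

Import Order.TTheory GRing.Theory Num.Theory.

Local Open Scope ring_scope.

Declare Scope opt_scope.
Delimit Scope opt_scope with opt.

(** Transport of an event along equalities of its input and output systems;
    it is needed because associativity and unitality of the composition of
    systems are propositional equalities. *)
Definition hcast (O : Type) (H : O -> O -> Type) (A A' B B' : O)
    (eA : A = A') (eB : B = B') (f : H A B) : H A' B' :=
  ecast X (H X B') eA (ecast Y (H A Y) eB f).

(** Strict symmetric monoidal structure of systems and events.
    [seqc g f] is the sequential composition "g after f". *)
Record strictSMC := StrictSMC {
  sys : Type;
  sunit : sys;
  smul : sys -> sys -> sys;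
  smulA : forall A B C, smul (smul A B) C = smul A (smul B C);
  smul1s : forall A, smul sunit A = A;
  smuls1 : forall A, smul A sunit = A;

  evt : sys -> sys -> Type;
  idev : forall A, evt A A;
  seqc : forall A B C, evt B C -> evt A B -> evt A C;
  parc : forall A B C D, evt A C -> evt B D -> evt (smul A B) (smul C D);
  swap : forall A B, evt (smul A B) (smul B A);

  seqcA : forall A B C D (h : evt C D) (g : evt B C) (f : evt A B),
    seqc h (seqc g f) = seqc (seqc h g) f;
  seq1c : forall A B (f : evt A B), seqc (idev B) f = f;
  seqc1 : forall A B (f : evt A B), seqc f (idev A) = f;

  parc_seqc : forall A A' A'' B B' B''
      (f' : evt A' A'') (f : evt A A') (g' : evt B' B'') (g : evt B B'),
    seqc (parc f' g') (parc f g) = parc (seqc f' f) (seqc g' g);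
  parc_id : forall A B, parc (idev A) (idev B) = idev (smul A B);
  parcA : forall A B C A' B' C' (f : evt A A') (g : evt B B') (h : evt C C'),
    hcast (smulA A B C) (smulA A' B' C') (parc (parc f g) h)
      = parc f (parc g h);
  par1c : forall A B (f : evt A B),
    hcast (smul1s A) (smul1s B) (parc (idev sunit) f) = f;
  parc1 : forall A B (f : evt A B),
    hcast (smuls1 A) (smuls1 B) (parc f (idev sunit)) = f;

  swap_nat : forall A B A' B' (f : evt A A') (g : evt B B'),
    seqc (swap A' B') (parc f g) = seqc (parc g f) (swap A B);
  swapK : forall A B, seqc (swap B A) (swap A B) = idev (smul A B);
  swap_hexagon : forall A B C,
    swap A (smul B C)
      = seqc (hcast erefl (esym (smulA B C A)) (parc (idev B) (swap A C)))
             (hcast (smulA A B C) (smulA B A C) (parc (swap A B) (idev C)))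
}.

Arguments sunit {s}.
Arguments smul {s}.
Arguments smulA {s}.
Arguments smul1s {s}.
Arguments smuls1 {s}.
Arguments evt {s}.
Arguments idev {s}.
Arguments seqc {s A B C}.
Arguments parc {s A B C D}.
Arguments swap {s}.

Notation "A ** B" := (smul A B) (at level 40, left associativity) : opt_scope.
Notation "g ∘ f" := (seqc g f) (at level 40, left associativity) : opt_scope.
Notation "f ⊠ g" := (parc f g) (at level 39, left associativity) : opt_scope.

Local Open Scope opt_scope.

(** Events, tests and probabilities.  [coarse E Y] is the coarse-graining of
    [E] over the outcomes in [Y]; it is only meaningful, and only constrained,
    when [E] is a test.  The sequential and parallel composites of two tests
    have the pairs of outcomes as outcomes.  In [test_merge], [m] maps each
    outcome to the block in which it is merged, and blocks are nonempty. *)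
Record probTests (R : realType) := ProbTests {
  smc :> strictSMC;

  prob : @evt smc sunit sunit -> R;
  prob_inj : injective prob;
  prob_itv : forall p, 0 <= prob p <= 1;
  prob_seqc : forall p q, prob (p ∘ q) = prob p * prob q;
  prob_parc : forall p q,
    prob (hcast (smuls1 sunit) (smuls1 sunit) (p ⊠ q)) = prob p * prob q;

  test : forall (A B : sys smc) (X : finType), (X -> evt A B) -> Prop;
  evt_in_test : forall (A B : sys smc) (f : evt A B),
    exists (X : finType) (E : X -> evt A B) (x : X), test E /\ E x = f;
  prep_test : forall A : sys smc,
    exists (X : finType) (E : X -> evt sunit A), test E;
  obs_test : forall A : sys smc,
    exists (X : finType) (E : X -> evt A sunit), test E;
  test_id : forall A : sys smc, test (fun _ : unit => idev A);
  test_swap : forall A B : sys smc, test (fun _ : unit => swap A B);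
  test_seqc : forall (A B C : sys smc) (X Z : finType)
      (E : X -> evt B C) (F : Z -> evt A B),
    test E -> test F -> test (fun o : X * Z => E o.1 ∘ F o.2);
  test_parc : forall (A B C D : sys smc) (X Z : finType)
      (E : X -> evt A C) (F : Z -> evt B D),
    test E -> test F -> test (fun o : X * Z => E o.1 ⊠ F o.2);
  test_prob : forall (X : finType) (E : X -> evt sunit sunit),
    test E -> \sum_x prob (E x) = 1;

  coarse : forall (A B : sys smc) (X : finType),
    (X -> evt A B) -> {set X} -> evt A B;
  coarse1 : forall (A B : sys smc) (X : finType) (E : X -> evt A B) (x : X),
    test E -> coarse E [set x] = E x;
  test_merge : forall (A B : sys smc) (X Z : finType) (E : X -> evt A B)
      (m : X -> Z), (forall z, exists x, m x = z) ->
    test E -> test (fun z => coarse E [set x | m x == z]);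
  coarse_seqc : forall (A B C : sys smc) (X Z : finType)
      (E : X -> evt B C) (F : Z -> evt A B) (Y : {set X}) (W : {set Z}),
    test E -> test F ->
    coarse E Y ∘ coarse F W
      = coarse (fun o : X * Z => E o.1 ∘ F o.2)
               [set o | (o.1 \in Y) && (o.2 \in W)];
  coarse_parc : forall (A B C D : sys smc) (X Z : finType)
      (E : X -> evt A C) (F : Z -> evt B D) (Y : {set X}) (W : {set Z}),
    test E -> test F ->
    coarse E Y ⊠ coarse F W
      = coarse (fun o : X * Z => E o.1 ⊠ F o.2)
               [set o | (o.1 \in Y) && (o.2 \in W)];
  prob_coarse : forall (X : finType) (E : X -> evt sunit sunit) (Y : {set X}),
    test E -> prob (coarse E Y) = \sum_(x in Y) prob (E x)
}.

Section StatesEffects.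
Context {R : realType} {T : probTests R}.
Implicit Types A B : sys T.

Definition state A : Type := evt (sunit : sys T) A.
Definition effect A : Type := evt A (sunit : sys T).

(** (a | rho) *)
Definition pairing A (a : effect A) (rho : state A) : R := prob (a ∘ rho).

Definition deterministic A B (f : evt A B) : Prop := test (fun _ : unit => f).

(** States are identified with the functionals that they induce on effects;
    [St_R A] is their real span. *)
Definition stvec A (rho : state A) : effect A -> R^o :=
  fun a => pairing a rho.

Definition St_R A (v : effect A -> R^o) : Prop :=
  exists (n : nat) (c : 'I_n -> R) (rho : 'I_n -> state A),
    v = \sum_(i < n) c i *: stvec (rho i).

Definition finite_dim A : Prop :=
  exists (n : nat) (b : 'I_n -> (effect A -> R^o)),
    (forall i, St_R (b i)) /\
    (forall v, St_R v -> exists c : 'I_n -> R, v = \sum_(i < n) c i *: b i).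

Definition null_state A (rho : state A) : Prop := stvec rho = 0.

Definition state_par A B (alpha : state A) (beta : state B) : state (A ** B) :=
  hcast (smuls1 sunit) erefl (alpha ⊠ beta).

Definition effect_par A B (a : effect A) (b : effect B) : effect (A ** B) :=
  hcast erefl (smuls1 sunit) (a ⊠ b).

End StatesEffects.

(** In [evt_ext] a context is a preparation of the input together with an
    ancilla [C] and an observation of the output together with [C]; by means of
    swaps, every context can be put in this form. *)
Record OPT (R : realType) := Opt {
  ptests :> probTests R;
  evt_ext : forall (A B : sys ptests) (f g : evt A B),
    (forall (C : sys ptests) (rho : state (A ** C)) (a : effect (B ** C)),
        pairing a ((f ⊠ idev C) ∘ rho) = pairing a ((g ⊠ idev C) ∘ rho)) ->
    f = g;
  effects_separate : forall (A : sys ptests) (rho sigma : state A),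
    (forall a : effect A, pairing a rho = pairing a sigma) -> rho = sigma;
  states_separate : forall (A : sys ptests) (a b : effect A),
    (forall rho : state A, pairing a rho = pairing b rho) -> a = b;
  St_R_finite_dim : forall A : sys ptests, finite_dim A;
  null_state_ex : forall A : sys ptests,
    exists eps : state A, null_state eps;
  state_detP : forall (A : sys ptests) (rho : state A),
    deterministic rho <->
    (forall a : effect A, deterministic a -> pairing a rho = 1)
}.

Section LocalDiscriminability.
Context {R : realType} (Theta : OPT R).

(** The m.+1-partite system S_0 ... S_m. *)
Fixpoint multi (m : nat) : ('I_m.+1 -> sys Theta) -> sys Theta :=
  match m with
  | 0 => fun S => S ord0
  | m'.+1 => fun S => S ord0 ** multi (fun i : 'I_m'.+1 => S (lift ord0 i))
  end.

Fixpoint multi_effect (m : nat) : forall S : 'I_m.+1 -> sys Theta,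
    (forall i, effect (S i)) -> effect (multi S) :=
  match m return forall S : 'I_m.+1 -> sys Theta,
    (forall i, effect (S i)) -> effect (multi S) with
  | 0 => fun S a => a ord0
  | m'.+1 => fun S a =>
      effect_par (a ord0)
        (multi_effect (fun i : 'I_m'.+1 => a (lift ord0 i)))
  end.

(** Conic combinations of product effects, as functionals on states. *)
Definition product_effect_cone (m : nat) (S : 'I_m.+1 -> sys Theta)
    (f : state (multi S) -> R) : Prop :=
  exists (n : nat) (c : 'I_n -> R) (a : 'I_n -> forall i, effect (S i)),
    (forall k, 0 <= c k) /\
    (forall rho, f rho = \sum_(k < n) c k * pairing (multi_effect (a k)) rho).

Definition local_discriminability : Prop :=
  forall (m : nat) (S : 'I_m.+1 -> sys Theta) (rho sigma : state (multi S)),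
    (forall f, product_effect_cone f -> f rho = f sigma) -> rho = sigma.

End LocalDiscriminability.

Section Entanglement.
Context {R : realType} (Theta : OPT R).

Definition separable (A B : sys Theta) (psi : state (A ** B)) : Prop :=
  exists (n : nat) (p : 'I_n -> R)
      (alpha : 'I_n -> state A) (beta : 'I_n -> state B),
    (forall i, 0 < p i /\ ~ null_state (alpha i) /\ ~ null_state (beta i)) /\
    stvec psi = \sum_(i < n) p i *: stvec (state_par (alpha i) (beta i)).

Definition entangled (A B : sys Theta) (psi : state (A ** B)) : Prop :=
  ~ separable psi.

Definition admits_entangled_states : Prop :=
  exists (A B : sys Theta) (psi : state (A ** B)), entangled psi.

End Entanglement.

(* Main.v *)
Require Import Defs.
From mathcomp Require Import all_boot all_order all_algebra.
From mathcomp Require Import boolp functions reals.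

(** If no state is entangled, the difference of two states of [A ** B] is a
    signed sum [D] of terms [c k * (alpha k ⊠ beta k)].  Given an effect [E] on
    [A ** B], let [M k j] be the pairing of [E] with [alpha k ⊠ beta j].  The
    columns of [M] are the values of effects of [A] on the [alpha k], and its
    rows those of effects of [B] on the [beta j].  Hence, if product effects
    vanish on [D], then [M *m diag c *m M = 0], so [diag c *m M] squares to [0]
    and has trace [0]; this trace is the value of [E] on [D].  So product
    effects separate bipartite states.  The multipartite case follows by
    induction, applying an effect to the first system. *)

Set Implicit Arguments.
Unset Strict Implicit.
Unset Printing Implicit Defensive.

Import GRing.Theory.

Local Open Scope ring_scope.
Local Open Scope opt_scope.

(** Factor [A] at full rank as [C *m B]. Then [C *m (B *m C) *m B] is [A *m A], and cancelling [C]
    and [B] gives [B *m C = 0], whose trace is that of [A]. *)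
Lemma mxtrace_sqr_eq0 (F : fieldType) (n : nat) (A : 'M[F]_n) :
  A *m A = 0 -> \tr A = 0.
Proof.
move=> AA0; rewrite -(mulmx_base A) mxtrace_mulC.
suff -> : row_base A *m col_base A = 0 by rewrite mxtrace0.
apply: (row_full_inj (col_base_full A)); apply: (row_free_inj (row_base_free A)).
by rewrite mulmx0 mul0mx mulmxA mulmx_base -mulmxA mulmx_base.
Qed.

(** Used to extend a family of effects of the tail systems by one of the first system. The
    transports disappear because equality proofs between ordinals are unique. *)
Lemma dfun_ord_cons (m : nat) (F : 'I_m.+2 -> Type) (x : F ord0)
    (f : forall i, F (lift ord0 i)) :
  exists g : forall i, F i, g ord0 = x /\ (fun i => g (lift ord0 i)) = f.
Proof.
exists (fun i => match unliftP ord0 i with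
  | UnliftSome j e => ecast k (F k) (esym e) (f j)
  | UnliftNone e => ecast k (F k) (esym e) x
  end); split.
  case: unliftP => [j e | e]; first by case/eqP: (neq_lift ord0 j).
  by rewrite eq_axiomK.
apply: functional_extensionality_dep => i.
case: unliftP => [j e | e]; last by case/eqP: (neq_lift ord0 i).
by have eij := lift_inj e; case: _ / eij in e *; rewrite eq_axiomK.
Qed.

Section Casts.
Context {C : strictSMC}.
Implicit Types X Y Z : sys C.

Lemma hcast_seqc X X' Y Y' Z Z' (eX : X = X') (eY : Y = Y') (eZ : Z = Z')
    (g : evt Y Z) (f : evt X Y) :
  hcast eX eZ (g ∘ f) = hcast eY eZ g ∘ hcast eX eY f.
Proof. by case: _ / eX; case: _ / eY; case: _ / eZ. Qed.

End Casts.

Section ProductEffects.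
Context {R : realType} {T : probTests R}.
Implicit Types A B : sys T.

Lemma pairing_seqc A B (a : effect B) (f : evt A B) (rho : state A) :
  pairing a (f ∘ rho) = pairing (a ∘ f) rho.
Proof. by rewrite /pairing seqcA. Qed.

(** Moving [beta] into an event on [A] turns an effect of [A ** B] into an effect of [A];
    [state_parEr] does the same for [B]. *)
Lemma state_parEl A B (alpha : state A) (beta : state B) :
  state_par alpha beta = hcast (smuls1 A) erefl (idev A ⊠ beta) ∘ alpha.
Proof.
by rewrite -[in RHS](parc1 alpha) -hcast_seqc parc_seqc seq1c seqc1.
Qed.

Lemma state_parEr A B (alpha : state A) (beta : state B) :
  state_par alpha beta = hcast (smul1s B) erefl (alpha ⊠ idev B) ∘ beta.
Proof.
rewrite -[in RHS](par1c beta) -hcast_seqc parc_seqc seq1c seqc1.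
(* The casts use two proofs of [sunit ** sunit = sunit], identified by proof irrelevance. *)
by rewrite /state_par (Prop_irrelevance (smuls1 sunit) (smul1s sunit)).
Qed.

Lemma effect_parE A B (a : effect A) (b : effect B) :
  effect_par a b = b ∘ hcast erefl (smul1s B) (a ⊠ idev B).
Proof.
rewrite -[in RHS](par1c b) -hcast_seqc parc_seqc seq1c seqc1.
by rewrite /effect_par (Prop_irrelevance (smuls1 sunit) (smul1s sunit)).
Qed.

Lemma pairing_par A B (a : effect A) (b : effect B)
    (alpha : state A) (beta : state B) :
  pairing (effect_par a b) (state_par alpha beta)
    = pairing a alpha * pairing b beta.
Proof.
by rewrite /pairing /effect_par /state_par -hcast_seqc parc_seqc prob_parc.
Qed.

Lemma product_effects_separate_sums A B (n : nat) (c : 'I_n -> R)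
    (alpha : 'I_n -> state A) (beta : 'I_n -> state B) (E : effect (A ** B)) :
  (forall (a : effect A) (b : effect B),
     \sum_(k < n) c k * (pairing a (alpha k) * pairing b (beta k)) = 0) ->
  \sum_(k < n) c k * pairing E (state_par (alpha k) (beta k)) = 0.
Proof.
move=> ab0.
pose M := \matrix_(k < n, j < n) pairing E (state_par (alpha k) (beta j)).
pose D := diag_mx (\row_(k < n) c k).
have MDM0 : M *m D *m M = 0.
  apply/matrixP => i j; rewrite -mulmxA mul_diag_mx !mxE.
  (* In the entry [(i, j)], the factor [M k j] is an effect of [A] on [alpha k], with [beta j]
     absorbed into [E]; [M i k] is an effect of [B] on [beta k], with [alpha i] absorbed. *)
  rewrite -[RHS](ab0 (E ∘ hcast (smuls1 A) erefl (idev A ⊠ beta j))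
                     (E ∘ hcast (smul1s B) erefl (alpha i ⊠ idev B))).
  apply: eq_bigr => k _; rewrite !mxE -!pairing_seqc -state_parEl -state_parEr.
  by rewrite mulrCA [_ * pairing _ _]mulrC.
have <- : \tr (D *m M)
    = \sum_(k < n) c k * pairing E (state_par (alpha k) (beta k)).
  by apply: eq_bigr => k _; rewrite mul_diag_mx !mxE.
by apply: mxtrace_sqr_eq0; rewrite -mulmxA [M *m _]mulmxA MDM0 mulmx0.
Qed.

End ProductEffects.

Section NoEntanglement.
Context {R : realType} (Theta : OPT R).

Lemma separable_pairing (A B : sys Theta) (psi : state (A ** B)) :
  separable psi ->
  exists (n : nat) (p : 'I_n -> R)
      (alpha : 'I_n -> state A) (beta : 'I_n -> state B),
    forall E : effect (A ** B),
      pairing E psi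
        = \sum_(i < n) p i * pairing E (state_par (alpha i) (beta i)).
Proof.
case=> n [p] [alpha] [beta] [_ psiE]; exists n, p, alpha, beta => E.
by have /(congr1 (@^~ E)) := psiE; rewrite fct_sumE.
Qed.

Hypothesis all_separable :
  forall (A B : sys Theta) (psi : state (A ** B)), separable psi.

Lemma product_effects_separate (A B : sys Theta) (rho sigma : state (A ** B)) :
  (forall (a : effect A) (b : effect B),
     pairing (effect_par a b) rho = pairing (effect_par a b) sigma) ->
  rho = sigma.
Proof.
move=> ab; apply: effects_separate => E; apply/eqP; rewrite -subr_eq0.
have [n1 [p1 [al1 [be1 rhoE]]]] := separable_pairing (all_separable rho).
have [n2 [p2 [al2 [be2 sigmaE]]]] := separable_pairing (all_separable sigma).
pose glue (X : Type) (f1 : 'I_n1 -> X) (f2 : 'I_n2 -> X) (k : 'I_(n1 + n2)) :=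
  match fintype.split k with inl i => f1 i | inr j => f2 j end.
(* The two decompositions are concatenated, that of [sigma] with opposite signs. *)
pose c := glue _ p1 (fun j => - p2 j).
have diffE F : pairing F rho - pairing F sigma
    = \sum_(k < n1 + n2)
        c k * pairing F (state_par (glue _ al1 al2 k) (glue _ be1 be2 k)).
  rewrite rhoE sigmaE -sumrN big_split_ord /=.
  congr +%R; apply: eq_bigr => i _; rewrite /c /glue.
    by rewrite (unsplitK (inl i)).
  by rewrite (unsplitK (inr i)) mulNr.
rewrite diffE; apply/eqP/product_effects_separate_sums => a b.
under eq_bigr do rewrite -pairing_par.
by rewrite -diffE ab subrr.
Qed.

Lemma multi_effects_separate (m : nat) (S : 'I_m.+1 -> sys Theta)
    (rho sigma : state (multi S)) :
  (forall a : forall i, effect (S i),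
     pairing (multi_effect a) rho = pairing (multi_effect a) sigma) ->
  rho = sigma.
Proof.
elim: m S rho sigma => [|m IHm] S rho sigma rho_sigma.
  apply: effects_separate => a0.
  have := rho_sigma (fun i => ecast j (effect (S j)) (esym (ord1 i)) a0).
  by rewrite /= eq_axiomK.
(* Applying [a] to the first system leaves two states of the tail; the induction hypothesis makes
   them equal, before [b] is applied. *)
apply: product_effects_separate => a b; rewrite effect_parE -!pairing_seqc.
congr pairing; apply: IHm => a'; rewrite !pairing_seqc -effect_parE.
have [g [g0 gS]] := @dfun_ord_cons m (fun i => effect (S i)) a a'.
by have := rho_sigma g; rewrite /= g0 gS.
Qed.

Lemma local_discriminability_of_separable : local_discriminability Theta.
Proof.
move=> m S rho sigma cone_eq; apply: multi_effects_separate => a.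
apply: (cone_eq (pairing (multi_effect a))).
exists 1%N, (fun=> 1), (fun=> a); split=> [_|psi]; first exact: Num.Theory.ler01.
by rewrite big_ord1 mul1r.
Qed.

End NoEntanglement.

Theorem proposition2 (R : realType) (Theta : OPT R) :
  ~ local_discriminability Theta -> admits_entangled_states Theta.
Proof.
move=> nLD; apply: contrapT => no_entangled; apply: nLD.
apply: local_discriminability_of_separable => A B psi.
by apply: contrapT => psi_ent; apply: no_entangled; exists A, B, psi.
Qed.
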